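(* Let $n$ be a square-free positive integer. Then the number of orbits in $M_{-n}$ under the action of $G=\mathrm{PSL}(2,\mathbb{Z})$ is $$|\mathcal{O}^G(M_{-n})| = \begin{cases} 2 & \text{if } n=1,\\ d(n)+|T^+(-n)| & \text{otherwise,}\end{cases}$$ and also $$|\mathcal{O}^G(M_{-n})| = \begin{cases} 2 & \text{if } n=1,\\ 4 & \text{if } n=3,\\ d(n)+\tfrac{2}{3}\,|A^+(-n)| & \text{otherwise.}\end{cases}$$ Moreover, $|\mathcal{O}^G(M_{-n})|\equiv 0 \pmod 4$ whenever $n\neq 1$ and $n\neq 2$.
   Context: $\mathbb{N}$ denotes the positive integers. For a square-free positive integer $n$, $M_{-n}=\{\frac{a+\sqrt{-n}}{c}\in\mathbb{Q}(\sqrt{-n}) : a,\ b=\frac{a^2+n}{c},\ c\in\mathbb{Z}\}$ (so $c\neq 0$ may be positive or negative, and $c\mid a^2+n$). For $\alpha=\frac{a+\sqrt{-n}}{c}\in M_{-n}$ write $a_\alpha=a$, $b_\alpha=b=\frac{a^2+n}{c}$, $c_\alpha=c$. $G=\mathrm{PSL}(2,\mathbb{Z})$ acts on $M_{-n}$ by Möbius transformations $z\mapsto (pz+q)/(rz+s)$, $p,q,r,s\in\mathbb{Z}$, $ps-qr=1$; $\mathcal{O}^G(M_{-n})$ is the set of orbits. Let $y\in G$ be the transformation $y(z)=(z-1)/z$. An element $\alpha\in M_{-n}$ is totally positive if $a_\alpha c_\alpha>0$. A totally positive triple in $M_{-n}$ is a set $\{\alpha,y(\alpha),y^2(\alpha)\}$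 with $\alpha\in M_{-n}$ such that $\alpha,y(\alpha),y^2(\alpha)$ are all totally positive (if $\alpha$ is fixed by $y$ this set has one element); $T^+(-n)$ is the set of all totally positive triples in $M_{-n}$. $A^+(-n)=\{(a,b,c)\in\mathbb{N}^3 : \frac{a+\sqrt{-n}}{c}\in M_{-n},\ b=\frac{a^2+n}{c},\ b>a,\ c>a\}$. $d(n)$ is the number of positive divisors of $n$. *)

(* Defs.v *)
From mathcomp Require Import all_boot all_order all_algebra all_field.
From mathcomp Require Import finmap.
From mathcomp Require Import boolp classical_sets functions cardinality.

Set Implicit Arguments.
Unset Strict Implicit.
Unset Printing Implicit Defensive.

Import Order.TTheory GRing.Theory Num.Theory.

Local Open Scope classical_set_scope.
Local Open Scope ring_scope.

Definition squarefree (n : nat) : Prop :=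
  (0 < n)%N /\ forall d : nat, (d ^ 2 %| n)%N -> d = 1%N.

(* Only meaningful when A is finite: fset_set A is empty otherwise. *)
Definition fincard (T : choiceType) (A : set T) : nat := #|` fset_set A|%fset.

(* sqrtC (- n) is i times the nonnegative real square root of n. *)
Definition quad (n : nat) (a c : int) : algC :=
  (a%:~R + sqrtC (- n%:R)) / c%:~R.

(* For n > 0 the pair (a, c) is determined by alpha, so that the existential
   quantifiers over (a, c) below speak about a_alpha and c_alpha. *)
Definition has_coords (n : nat) (alpha : algC) (a c : int) : Prop :=
  [/\ c <> 0, (c %| a ^+ 2 + n%:Z)%Z & alpha = quad n a c].

Definition Mneg (n : nat) : set algC :=
  [set alpha | exists a c : int, has_coords n alpha a c].

(* The denominator does not vanish at a non-real z when p s - q r = 1, so the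
   convention x / 0 = 0 plays no role on Mneg n for n > 0. *)
Definition mobius (p q r s : int) (z : algC) : algC :=
  (p%:~R * z + q%:~R) / (r%:~R * z + s%:~R).

(* PSL(2, Z) as a set of transformations: two integer matrices of determinant 1
   induce the same one if and only if they agree up to sign. *)
Definition PSL2Z : set (algC -> algC) :=
  [set g | exists p q r s : int, p * s - q * r = 1 /\ g = mobius p q r s].

Definition Gorbit (z : algC) : set algC := [set g z | g in PSL2Z].

Definition orbits (n : nat) : set (set algC) := [set Gorbit z | z in Mneg n].

Definition ymap : algC -> algC := fun z => (z - 1) / z.

Definition totally_positive (n : nat) (alpha : algC) : Prop :=
  exists a c : int, has_coords n alpha a c /\ 0 < a * c.

Definition Tplus (n : nat) : set (set algC) :=
  [set S | exists alpha : algC,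
     [/\ Mneg n alpha, totally_positive n alpha, totally_positive n (ymap alpha),
         totally_positive n (ymap (ymap alpha))
       & S = [set alpha; ymap alpha; ymap (ymap alpha)]]].

Definition Aplus (n : nat) : set (nat * nat * nat) :=
  [set t | let: (a, b, c) := t in
     [/\ (0 < a)%N, (0 < b)%N & (0 < c)%N] /\
     [/\ Mneg n (quad n a%:Z c%:Z), (b * c = a ^ 2 + n)%N, (a < b)%N
       & (a < c)%N]].

Definition ndivisors (n : nat) : nat := size (divisors n).

(* Main.v *)
Require Import Defs.
From mathcomp Require Import all_boot all_order all_algebra all_field.
From mathcomp Require Import finmap.
From mathcomp Require Import boolp classical_sets functions cardinality.
From mathcomp Require Import zify ring.

Import Order.TTheory GRing.Theory Num.Theory.

Local Open Scope classical_set_scope.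
Local Open Scope ring_scope.

(** An element (a + sqrt(-n)) / c of M_{-n}, with b c = a^2 + n, is a root of
    the integral form c z^2 - 2 a z + b.  The proof replaces (a, b, c) by the
    Selling parameters (x, y, w) = (a, b - a, c - a), in which b c = a^2 + n
    becomes the symmetric equation x y + y w + w x = n.  In these coordinates
    the map z -> (z - 1) / z is the cyclic shift (x, y, w) -> (y, w, x)
    ([ymap_surd]), complex conjugation is the change of all three signs, and
    totally positive triples are the cyclic classes of solutions whose entries
    are all positive or all negative ([totally_positive_triple]).

    Selling reduction classifies the orbits.  Up to the change of signs the
    form is positive definite; as long as some parameter is negative, shifting
    it to the front and applying z -> -1/z lowers x + y + w, so every orbit
    contains a solution with nonnegative entries ([exists_nonneg]).  Conversely
    a unimodular substitution turns x + y + w into x N1 + y N2 + w N3, where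
    the N's are values of the form u^2 - u v + v^2 at nonzero integer vectors,
    hence at least 1 ([tsum_transform]).  So two equivalent nonnegative
    solutions have the same sum, and if the entries of one are positive then
    all the N's are 1, which leaves only the cyclic shifts
    ([equivalent_positive]).

    An orbit is therefore of one of two kinds.  Positive solutions up to cyclic
    shift, with a sign, correspond to totally positive triples; solutions
    (0, y, w) with y w = n, up to the exchange of y and w, with a sign,
    correspond to the divisors of n, because n is not a square when n <> 1.
    This gives d(n) + |T^+(-n)|.  The set A^+(-n) is the set of positive
    solutions, and cyclic classes have three elements unless x = y = w, which
    forces n = 3 when n is square-free.

    For the congruence modulo 4 write k for the number of positive solutions
    up to cyclic shift and s for the number of divisors below sqrt(n); there
    are 2 (k + s) orbits and, for n <> 3, there are 3 k positive solutions.
    The exchange of y and w shows that 3 k has the parity of the number of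
    positive solutions with y = w, that is of factorizations
    n = y (2 x + y).  If n is odd there are s of them, and k + s is even.  If n
    is even there are none since 4 does not divide n, so k is even.  In that
    case 2 s = d(n) = 2 d(n/2), and d(n/2) is even because n/2, being square-free
    and different from 1, is not a square; so s is even as well. *)

(** * Selling coordinates and the action of the modular group *)

Definition triple : Type := (int * int * int)%type.

Definition selling (n : nat) : set triple :=
  [set t | let: (x, y, w) := t in x * y + y * w + w * x = n%:Z].

Definition tsum (t : triple) : int := let: (x, y, w) := t in x + y + w.

Definition cyc (t : triple) : triple := let: (x, y, w) := t in (y, w, x).

Definition negt (t : triple) : triple := let: (x, y, w) := t in (- x, - y, - w).

(** The action of the integer matrix [[p, q], [r, s]] of determinant 1 on z,
    read off on the Selling parameters of z. *)
Definition transform (p q r s : int) (t : triple) : triple :=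
  let: (x, y, w) := t in
  (x * (p + q) * (r + s) + y * p * r + w * q * s,
   x * (p + q) * (p + q - r - s) + y * p * (p - r) + w * q * (q - s),
   x * (r + s) * (r + s - p - q) + y * r * (r - p) + w * s * (s - q)).

Definition equivalent (t t' : triple) : Prop :=
  exists p q r s : int, p * s - q * r = 1 /\ t' = transform p q r s t.

(** The parameter y is left out because it is determined by the other two:
    (x + w) (x + y) = x^2 + n. *)
Definition surd (n : nat) (t : triple) : algC :=
  let: (x, _, w) := t in quad n x (x + w).

Lemma equivalent_refl t : equivalent t t.
Proof.
exists 1, 0, 0, 1; split; first by ring.
by case: t => -[x y] w; congr (_, _, _); ring.
Qed.

Lemma equivalent_trans t1 t2 t3 :
  equivalent t1 t2 -> equivalent t2 t3 -> equivalent t1 t3.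
Proof.
case: t1 => -[x y] w [p [q [r [s [d1 ->]]]]] [p' [q' [r' [s' [d2 ->]]]]].
exists (p' * p + q' * r), (p' * q + q' * s), (r' * p + s' * r),
  (r' * q + s' * s); split; last by congr (_, _, _); ring.
transitivity ((p' * s' - q' * r') * (p * s - q * r)); first by ring.
by rewrite d1 d2.
Qed.

Lemma equivalent_sym t t' : equivalent t t' -> equivalent t' t.
Proof.
case: t => -[x y] w [p [q [r [s [d ->]]]]].
exists s, (- q), (- r), p; split; first by rewrite -d; ring.
congr (_, _, _).
- transitivity ((p * s - q * r) ^+ 2 * x); first by rewrite d; ring.
  by ring.
- transitivity ((p * s - q * r) ^+ 2 * y); first by rewrite d; ring.
  by ring.
- transitivity ((p * s - q * r) ^+ 2 * w); first by rewrite d; ring.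
  by ring.
Qed.

(** The matrix [[1, -1], [1, 0]] is that of the map z -> (z - 1) / z. *)
Lemma equivalent_cyc t : equivalent t (cyc t).
Proof.
exists 1, (-1), 1, 0; split; first by ring.
by case: t => -[x y] w; congr (_, _, _); ring.
Qed.

Lemma equivalent_negt t t' : equivalent t t' -> equivalent (negt t) (negt t').
Proof.
case: t => -[x y] w [p [q [r [s [d ->]]]]].
by exists p, q, r, s; split => //; congr (_, _, _); ring.
Qed.

Lemma equivalent_selling n t t' :
  equivalent t t' -> selling n t -> selling n t'.
Proof.
case: t => -[x y] w [p [q [r [s [d ->]]]]]; rewrite /selling /= => <-.
transitivity ((p * s - q * r) ^+ 2 * (x * y + y * w + w * x)); first by ring.
by rewrite d; ring.
Qed.

Lemma selling_negt n t : selling n t -> selling n (negt t).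
Proof. by case: t => -[x y] w; rewrite /selling /= => <-; ring. Qed.

Lemma negtK : involutive negt.
Proof. by case=> -[x y] w /=; rewrite !opprK. Qed.

Lemma selling_cyc n t : selling n t -> selling n (cyc t).
Proof. by apply: equivalent_selling (equivalent_cyc t). Qed.

(** The denominator c = x + w cannot vanish because c b = x^2 + n > 0. *)
Lemma selling_neq0 n x y w : (0 < n)%N ->
  selling n (x, y, w) -> (x + w)%R != 0.
Proof.
rewrite /selling /= => n0 E; apply/eqP => c0.
have : (x + w) * (x + y) = x ^+ 2 + n%:Z by rewrite -E; ring.
by rewrite c0 mul0r; nia.
Qed.

(** * Elements of M_{-n} as Selling triples *)

(** If c and c' differed, clearing denominators would make sqrt(-n) rational,
    so that -n times a nonzero square would be a square. *)
Lemma quad_inj n a c a' c' : (0 < n)%N -> c != 0 -> c' != 0 ->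
  quad n a c = quad n a' c' -> a = a' /\ c = c'.
Proof.
move=> n0 c0 c'0; rewrite /quad; set k := sqrtC _.
have k2 : k ^+ 2 = - n%:R by exact: sqrtCK.
have C0 : c%:~R != 0 :> algC by rewrite intr_eq0.
have C'0 : c'%:~R != 0 :> algC by rewrite intr_eq0.
move/eqP; rewrite eqr_div // => /eqP E.
have E1 : k * (c' - c)%:~R = (a' * c - a * c')%:~R.
  have -> : k * (c' - c)%:~R = (a%:~R + k) * c'%:~R - (a'%:~R + k) * c%:~R
    + (a' * c - a * c')%:~R by ring.
  by rewrite E subrr add0r.
have E2 : - n%:Z * (c' - c) ^+ 2 = (a' * c - a * c') ^+ 2.
  apply: (@intr_inj algC).
  have -> : (- n%:Z * (c' - c) ^+ 2)%:~R = k ^+ 2 * ((c' - c)%:~R) ^+ 2 :> algC.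
    by rewrite k2; ring.
  by rewrite -exprMn E1; ring.
have cc : c = c'.
  have := sqr_ge0 (a' * c - a * c'); rewrite -E2 mulNr oppr_ge0 pmulr_rle0 //.
  by move=> h; apply/esym/eqP; rewrite -subr_eq0 -sqrf_eq0 eq_le h sqr_ge0.
split => //; subst c'.
by move: E => /(mulIf C0) /addIr; apply: intr_inj.
Qed.

Lemma mobius_surd n p q r s t : (0 < n)%N -> selling n t ->
  p * s - q * r = 1 -> mobius p q r s (surd n t) = surd n (transform p q r s t).
Proof.
move=> n0 St d.
have St' : selling n (transform p q r s t).
  by apply: equivalent_selling St; exists p, q, r, s.
case: t St St' => -[x y] w St St'.
have c0 := selling_neq0 _ _ _ _ n0 St.
have := selling_neq0 _ _ _ _ n0 St'.
rewrite /mobius /surd /= /quad; set k := sqrtC _.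
have k2 : k ^+ 2 = - n%:R by exact: sqrtCK.
have {}k2 : k ^+ 2 = - (x * y + y * w + w * x)%:~R.
  by rewrite k2; move: St; rewrite /selling /= => ->.
set c' := (X in X != 0) => c'0.
have C0 : (x + w)%:~R != 0 :> algC by rewrite intr_eq0.
have C'0 : c'%:~R != 0 :> algC by rewrite intr_eq0.
have d' : p%:~R * s%:~R - q%:~R * r%:~R = 1 :> algC.
  by rewrite -!intrM -intrB d.
(* The denominator times its conjugate is c c'. *)
have den0 : r%:~R * (x%:~R + k) + s%:~R * (x + w)%:~R != 0 :> algC.
  have : (r%:~R * (x%:~R + k) + s%:~R * (x + w)%:~R) *
         (r%:~R * (x%:~R - k) + s%:~R * (x + w)%:~R) != 0 :> algC.
    have -> : (r%:~R * (x%:~R + k) + s%:~R * (x + w)%:~R) *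
         (r%:~R * (x%:~R - k) + s%:~R * (x + w)%:~R)
       = (x + w)%:~R * c'%:~R :> algC.
      by rewrite /c'; ring: k2.
    by rewrite mulf_neq0.
  by rewrite mulf_eq0 negb_or => /andP[].
have -> : r%:~R * ((x%:~R + k) / (x + w)%:~R) + s%:~R =
   (r%:~R * (x%:~R + k) + s%:~R * (x + w)%:~R) / (x + w)%:~R.
  by rewrite [RHS]mulrDl mulfK // mulrA.
have -> : p%:~R * ((x%:~R + k) / (x + w)%:~R) + q%:~R =
   (p%:~R * (x%:~R + k) + q%:~R * (x + w)%:~R) / (x + w)%:~R.
  by rewrite [RHS]mulrDl mulfK // mulrA.
rewrite -mulf_div divff ?invr_eq0 // mulr1.
apply/eqP; rewrite eqr_div //; apply/eqP.
(* With sqrt(-n) scaled by the determinant, both sides agree as polynomials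
   modulo the value of k ^+ 2. *)
have kE : k = (p%:~R * s%:~R - q%:~R * r%:~R) * k by rewrite d' mul1r.
by rewrite [X in _ = (_ + X) * _]kE /c'; ring: k2.
Qed.

Lemma Mneg_surd n z : (0 < n)%N ->
  Mneg n z <-> exists2 t : triple, selling n t & z = surd n t.
Proof.
move=> n0; split.
  move=> [a [c [c0 /dvdzP[b bE] ->]]].
  exists (a, b - a, c - a); last by rewrite /surd; congr quad; ring.
  by rewrite /selling /=; apply: (addrI (a ^+ 2)); rewrite bE; ring.
move=> [[[x y] w] St ->]; exists x, (x + w); split => //.
  exact/eqP/(selling_neq0 _ _ _ _ n0 St).
apply/dvdzP; exists (x + y); move: St; rewrite /selling /= => <-.
by ring.
Qed.

Lemma surd_inj n t t' : (0 < n)%N -> selling n t -> selling n t' ->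
  surd n t = surd n t' -> t = t'.
Proof.
case: t t' => -[x y] w [[x' y'] w'] n0 St St'.
have c0 := selling_neq0 _ _ _ _ n0 St; have c'0 := selling_neq0 _ _ _ _ n0 St'.
move=> /(quad_inj _ _ _ _ _ n0 c0 c'0) [xx cc].
have ww : w = w' by lia.
subst x' w'; congr (_, _, _); apply: (mulfI c0).
apply: (addIr (w * x)); move: St St'; rewrite /selling /= => E E'.
transitivity n%:Z; first by rewrite -E; ring.
by rewrite -E'; ring.
Qed.

Lemma Gorbit_surd n t : (0 < n)%N -> selling n t ->
  Gorbit (surd n t) = [set surd n t' | t' in equivalent t].
Proof.
move=> n0 St; apply/seteqP; split => z.
  move=> [g [p [q [r [s [d ->]]]]] <-]; exists (transform p q r s t).
    by exists p, q, r, s.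
  by rewrite mobius_surd.
move=> [t' [p [q [r [s [d ->]]]]] <-]; exists (mobius p q r s).
  by exists p, q, r, s.
by rewrite mobius_surd.
Qed.

(** Being an equivalence relation, [equivalent] makes an orbit the class of any
    of its points. *)
Lemma Gorbit_eq n t t' : (0 < n)%N -> selling n t -> selling n t' ->
  Gorbit (surd n t) = Gorbit (surd n t') <-> equivalent t t'.
Proof.
move=> n0 St St'; rewrite !Gorbit_surd //; split=> [E|e].
  have : [set surd n u | u in equivalent t'] (surd n t').
    by exists t' => //; exact: equivalent_refl.
  rewrite -E => -[u tu /surd_inj ut'].
  by rewrite -ut' //; apply: equivalent_selling tu St.
apply/seteqP; split => z [u eu <-]; exists u => //.
  by apply: equivalent_trans (equivalent_sym _ _ e) eu.
exact: equivalent_trans e eu.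
Qed.

(** * Uniqueness of reduced triples *)

(** The norm form of the Eisenstein integers.  It controls how the sum of the
    Selling parameters changes under a unimodular substitution. *)
Definition hexnorm (u v : int) : int := u ^+ 2 - u * v + v ^+ 2.

Lemma hexnorm_ge1 u v : (u != 0) || (v != 0) -> 1 <= hexnorm u v.
Proof.
rewrite /hexnorm => h.
suff : 0 < u ^+ 2 - u * v + v ^+ 2 by lia.
rewrite -(@pmulr_rgt0 _ 4) //.
have -> : 4 * (u ^+ 2 - u * v + v ^+ 2) = (2 * u - v) ^+ 2 + 3 * v ^+ 2 by ring.
have [v0|v0] := eqVneq v 0.
  subst v; rewrite eqxx orbF in h.
  rewrite ltr_pwDl ?mulr_ge0 ?sqr_ge0 //.
  by rewrite lt0r sqr_ge0 sqrf_eq0 subr0 mulf_neq0.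
by rewrite ltr_wpDl ?sqr_ge0 // mulr_gt0 // lt0r sqr_ge0 sqrf_eq0 v0.
Qed.

Lemma hexnorm_eq1 u v : hexnorm u v = 1 ->
  [\/ u = 0 /\ (v = 1 \/ v = -1), v = 0 /\ (u = 1 \/ u = -1),
      u = 1 /\ v = 1 | u = -1 /\ v = -1].
Proof.
rewrite /hexnorm => h.
have hv : 3 * v ^+ 2 <= 4.
  have := sqr_ge0 (2 * u - v).
  have -> : (2 * u - v) ^+ 2 = 4 * (u ^+ 2 - u * v + v ^+ 2) - 3 * v ^+ 2 by ring.
  by rewrite h; lia.
have hu : 3 * u ^+ 2 <= 4.
  have := sqr_ge0 (2 * v - u).
  have -> : (2 * v - u) ^+ 2 = 4 * (u ^+ 2 - u * v + v ^+ 2) - 3 * u ^+ 2 by ring.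
  by rewrite h; lia.
have {}hv : v = 0 \/ v = 1 \/ v = -1 by nia.
have {}hu : u = 0 \/ u = 1 \/ u = -1 by nia.
by case: hu hv h => [->|[->|->]] [->|[->|->]] //= _;
  [ constructor 1; auto | constructor 1; auto | constructor 2; auto
  | constructor 3 | constructor 2; auto | constructor 4].
Qed.

Lemma tsum_transform p q r s x y w :
  tsum (transform p q r s (x, y, w)) =
  x * hexnorm (p + q) (r + s) + y * hexnorm p r + w * hexnorm q s.
Proof. by rewrite /tsum /transform /hexnorm; ring. Qed.

Definition nonneg (t : triple) : Prop :=
  let: (x, y, w) := t in [/\ 0 <= x, 0 <= y & 0 <= w].

Definition positive (t : triple) : Prop :=
  let: (x, y, w) := t in [/\ 0 < x, 0 < y & 0 < w].

Lemma hexnorm_unimodular {p q r s : int} : p * s - q * r = 1 ->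
  [/\ 1 <= hexnorm (p + q) (r + s), 1 <= hexnorm p r & 1 <= hexnorm q s].
Proof.
move=> d; split; apply: hexnorm_ge1; apply: contra_eqT d;
  rewrite negb_or !negbK => /andP[/eqP h1 /eqP h2].
- have -> : s = - r by lia.
  have -> : p = - q by lia.
  by rewrite mulrNN subrr.
- by rewrite h1 h2 mul0r mulr0.
- by rewrite h1 h2 mul0r mulr0.
Qed.

Lemma tsum_le t t' : nonneg t -> equivalent t t' -> tsum t <= tsum t'.
Proof.
case: t => -[x y] w [x0 y0 w0] [p [q [r [s [d ->]]]]].
rewrite tsum_transform; have [h1 h2 h3] := hexnorm_unimodular d.
by rewrite /tsum !lerD // ler_peMr.
Qed.

(** Sums of equivalent nonnegative triples agree, so by [tsum_transform] the
    three positive weights x, y, w are multiplied by norms that must all be 1.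
    The columns of the matrix are then among the six units, and the determinant
    condition leaves the three cyclic shifts. *)
Lemma equivalent_positive t t' : positive t -> nonneg t' -> equivalent t t' ->
  [\/ t' = t, t' = cyc t | t' = cyc (cyc t)].
Proof.
move=> pt nt' e.
have nt : nonneg t by case: t pt {e} => -[x y] w /= []; split; lia.
have E : tsum t' = tsum t.
  by apply: le_anti; rewrite !tsum_le //; apply: equivalent_sym.
case: t pt {nt} e E => -[x y] w [x0 y0 w0] [p [q [r [s [d t'E]]]]].
rewrite {1}t'E tsum_transform; have [h1 h2 h3] := hexnorm_unimodular d.
rewrite /tsum => E.
have hx : x <= x * hexnorm (p + q) (r + s) by rewrite ler_peMr // ltW.
have hy : y <= y * hexnorm p r by rewrite ler_peMr // ltW.
have hw : w <= w * hexnorm q s by rewrite ler_peMr // ltW.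
have e1 : hexnorm (p + q) (r + s) = 1.
  by apply: (@mulfI _ x); [rewrite gt_eqF | lia].
have e2 : hexnorm p r = 1 by apply: (@mulfI _ y); [rewrite gt_eqF | lia].
have e3 : hexnorm q s = 1 by apply: (@mulfI _ w); [rewrite gt_eqF | lia].
rewrite {}t'E {E hx hy hw h1 h2 h3 nt'} /transform /cyc.
case: (hexnorm_eq1 _ _ e2)
    => [[p0 [r0|r0]]|[r0 [p0|p0]]|[p0 r0]|[p0 r0]]; subst p r;
  case: (hexnorm_eq1 _ _ e3)
    => [[q0 [s0|s0]]|[s0 [q0|q0]]|[q0 s0]|[q0 s0]]; subst q s;
  first [ by exfalso; move: d; rewrite /=; lia
        | by exfalso; move: e1; rewrite /hexnorm; lia
        | by constructor 1; congr (_, _, _); ring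
        | by constructor 2; congr (_, _, _); ring
        | by constructor 3; congr (_, _, _); ring ].
Qed.

(** * Selling reduction *)

(** The form is definite, so the values c, b and b + c - 2 a of the form have
    the same sign. *)
Lemma selling_definite n x y w : (0 < n)%N -> selling n (x, y, w) ->
  0 < x + w -> 0 < x + y /\ 0 < y + w.
Proof.
rewrite /selling /= => n0 S xw.
have xy : 0 < x + y.
  rewrite -(pmulr_rgt0 _ xw).
  have -> : (x + w) * (x + y) = x ^+ 2 + n%:Z by rewrite -S; ring.
  by rewrite ltr_wpDl ?sqr_ge0.
split=> //; rewrite -(pmulr_rgt0 _ xw).
have -> : (x + w) * (y + w) = w ^+ 2 + n%:Z by rewrite -S; ring.
by rewrite ltr_wpDl ?sqr_ge0.
Qed.

(** The effect of z -> -1/z on the Selling parameters; the sum of the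
    parameters changes by 2 x. *)
Lemma equivalent_flip x y w :
  equivalent (x, y, w) (- x, w + 2 * x, y + 2 * x).
Proof.
by exists 0, (-1), 1, 0; split; [ring | congr (_, _, _); ring].
Qed.

(** Selling's algorithm.  The sum x + y + w stays positive, being half the sum
    of the three positive values in [selling_definite], and each flip at a
    negative parameter lowers it. *)
Lemma exists_nonneg n x y w : (0 < n)%N -> selling n (x, y, w) -> 0 < x + w ->
  exists2 t' : triple, equivalent (x, y, w) t' & nonneg t'.
Proof.
move=> n0; have [k] := ubnP (absz (x + y + w)).
elim: k x y w => // k IHk x y w hk St xw.
have [xy yw] := selling_definite _ _ _ _ n0 St xw.
(* Flip at a negative parameter that has been shifted to the front. *)
have descend x' y' w' : equivalent (x, y, w) (x', y', w') -> 0 < x' + w' ->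
    0 < x' + y' -> 0 < y' + w' -> x' + y' + w' = x + y + w -> x' < 0 ->
    exists2 t' : triple, equivalent (x, y, w) t' & nonneg t'.
  move=> e xw' xy' yw' sE x'0.
  have e' := equivalent_trans _ _ _ e (equivalent_flip x' y' w').
  have S' := equivalent_selling _ _ _ e' St.
  have p' : 0 < - x' + (y' + 2 * x') by lia.
  have [q1 q2] := selling_definite _ _ _ _ n0 S' p'.
  have [|t' et' nt'] := IHk _ _ _ _ S' p'; first by lia.
  by exists t' => //; apply: equivalent_trans e' et'.
have [x0|x0] := ltP x 0.
  by apply: (descend x y w) => //; apply: equivalent_refl.
have [y0|y0] := ltP y 0.
  by apply: (descend y w x) => //; [exact: equivalent_cyc | lia..].
have [w0|w0] := ltP w 0.
  apply: (descend w x y) => //; [|lia..].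
  exact: equivalent_trans (equivalent_cyc _) (equivalent_cyc _).
by exists (x, y, w) => //; exact: equivalent_refl.
Qed.

(** For positive definite forms, positivity of the Selling parameters means that
    the underlying lattice has a superbase with three obtuse angles. *)
Definition obtuse (n : nat) : set triple := selling n `&` positive.

(** One representative of each cyclic class of positive solutions: the first
    entry is minimal, and the mixed strict and large inequalities break the tie
    when the minimum is reached twice.  The constant triples are their own
    class. *)
Definition necklace (n : nat) : set triple :=
  [set t | obtuse n t /\
     let: (x, y, w) := t in (x < y /\ x <= w) \/ (x = y /\ y = w)].

(** The forms with a vanishing parameter, up to equivalence.  They are the
    diagonal forms with a = 0 and b c = n. *)
Definition rect (n : nat) : set triple :=
  [set t | selling n t /\ let: (x, y, w) := t in [/\ x = 0, 0 < w & w <= y]].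

Definition reduced (n : nat) : set triple := necklace n `|` rect n.

Definition signed (A : set triple) : set triple := A `|` negt @` A.

Lemma necklace_rotation n t : obtuse n t ->
  [\/ necklace n t, necklace n (cyc t) | necklace n (cyc (cyc t))].
Proof.
move=> [St]; have S1 := selling_cyc _ _ St; have S2 := selling_cyc _ _ S1.
move: St S1 S2; case: t => -[x y] w St S1 S2 [x0 y0 w0].
have : [\/ x < y /\ x <= w \/ x = y /\ y = w,
           y < w /\ y <= x \/ y = w /\ w = x |
           w < x /\ w <= y \/ w = x /\ x = y].
  have [] := ltgtP x y; have [] := ltgtP x w; have [] := ltgtP y w => *;
  first [ by constructor 1; lia | by constructor 2; lia | by constructor 3; lia].
by case=> h; [constructor 1 | constructor 2 | constructor 3].
Qed.

Lemma exists_reduced n x y w : (0 < n)%N -> selling n (x, y, w) -> 0 < x + w ->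
  exists2 t' : triple, equivalent (x, y, w) t' & reduced n t'.
Proof.
move=> n0 St xw.
have [u e nu] := exists_nonneg _ _ _ _ n0 St xw.
have {St} Su := equivalent_selling _ _ _ e St.
suff [t' et' rt'] : exists2 t' : triple, equivalent u t' & reduced n t'.
  by exists t' => //; apply: equivalent_trans e et'.
case: u nu Su {e xw x y w} => -[x y] w [x0 y0 w0] Su.
have eT t1 t2 t3 := @equivalent_trans t1 t2 t3.
have e1 := equivalent_cyc (x, y, w); have e2 := equivalent_cyc (cyc (x, y, w)).
have {}e2 := eT _ _ _ e1 e2.
have [p|np] := pselect (positive (x, y, w)).
  have [h|h|h] := necklace_rotation _ _ (conj Su p).
  - by exists (x, y, w); [exact: equivalent_refl | left].
  - by exists (cyc (x, y, w)); [exact: e1 | left].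
  - by exists (cyc (cyc (x, y, w))); [exact: e2 | left].
have rectP y' w' : equivalent (x, y, w) (0, y', w') -> 0 <= y' -> 0 <= w' ->
    exists2 t' : triple, equivalent (x, y, w) t' & reduced n t'.
  move=> e y'0 w'0; have S' := equivalent_selling _ _ _ e Su.
  have E : y' * w' = n%:Z by move: S'; rewrite /selling /=; lia.
  have y'1 : y' != 0 by apply: contra_eqN E => /eqP ->; rewrite mul0r; lia.
  have w'1 : w' != 0 by apply: contra_eqN E => /eqP ->; rewrite mulr0; lia.
  have [wy|yw] := leP w' y'.
    exists (0, y', w') => //; right; split => //; split => //; lia.
  have ef := eT _ _ _ e (equivalent_flip 0 y' w').
  have fE : (- 0, w' + 2 * 0, y' + 2 * 0) = (0, w', y') :> triple.
    by congr (_, _, _); lia.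
  rewrite {}fE in ef.
  exists (0, w', y') => //; right; split; last by split => //; lia.
  exact: equivalent_selling ef Su.
have [xE|x1] := eqVneq x 0.
  by apply: (rectP y w) => //; rewrite -xE; exact: equivalent_refl.
have [yE|y1] := eqVneq y 0.
  by apply: (rectP w x) => //; rewrite -yE; exact: e1.
have [wE|w1] := eqVneq w 0.
  by apply: (rectP x y) => //; rewrite -wE; exact: e2.
by case: np; split; lia.
Qed.

Lemma reduced_nonneg n t : (0 < n)%N -> reduced n t ->
  [/\ selling n t, nonneg t & 0 < tsum t].
Proof.
by move=> n0; case: t => -[x y] w [] [] => [[S [x0 y0 w0]] _|S [x0 y0 w0]];
  split => //; rewrite /nonneg /tsum /=; try split; lia.
Qed.

(** [equivalent_positive] settles the case where one triple is positive.  For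
    two triples (0, y, w) both the sum y + w and the product y w = n agree. *)
Lemma reduced_unique n t t' : (0 < n)%N -> reduced n t -> reduced n t' ->
  equivalent t t' -> t = t'.
Proof.
move=> n0 rt rt' e.
have [St nt pt] := reduced_nonneg _ _ n0 rt.
have [St' nt' pt'] := reduced_nonneg _ _ n0 rt'.
have es := equivalent_sym _ _ e.
have E : tsum t = tsum t' by apply: le_anti; rewrite !tsum_le.
have necklaceE u u' : necklace n u -> reduced n u' -> nonneg u' ->
    equivalent u u' -> u = u'.
  case: u => -[x y] w [[_ pu] hu] ru' nu' eu.
  have u'E := equivalent_positive _ _ pu nu' eu.
  case: pu => x0 y0 w0; case: ru' => [[_]|[_]];
    by case: u'E {eu nu'} => -> /=; try (case; lia); move=> h;
    congr (_, _, _); lia.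
case: (rt) => [nt'0|rt0]; first exact: necklaceE.
case: (rt') => [nt'0|rt'0]; first by apply/esym/necklaceE.
case: t t' rt0 rt'0 E {rt rt' e es St nt pt St' nt' pt'}
  => -[x y] w [[x' y'] w'] [S [x0 w0 wy]] [S' [x'0 w'0 wy']].
subst x x'; rewrite /tsum !add0r => E.
have {S} S : y * w = n%:Z by move: S; rewrite /selling /=; lia.
have {S'} S' : y' * w' = n%:Z by move: S'; rewrite /selling /=; lia.
have : (w - w') * (w - y') = 0.
  transitivity (w ^+ 2 - w * (y' + w') + y' * w'); first by ring.
  by rewrite -E S' -S; ring.
move/eqP; rewrite mulf_eq0 => /orP[] /eqP h; congr (_, _, _); lia.
Qed.

(** * Orbits and totally positive triples *)

Lemma tsum_negt t : tsum (negt t) = - tsum t.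
Proof. by case: t => -[x y] w; rewrite /tsum /=; ring. Qed.

Lemma signed_selling n t : (0 < n)%N -> signed (reduced n) t -> selling n t.
Proof.
move=> n0 [/(reduced_nonneg _ _ n0)[]//|[u /(reduced_nonneg _ _ n0)[Su _ _] <-]].
exact: selling_negt.
Qed.

(** A reduced triple and the opposite of a reduced triple are never equivalent,
    since the sum of a nonnegative triple cannot decrease. *)
Lemma signed_reduced_unique n t t' : (0 < n)%N ->
  signed (reduced n) t -> signed (reduced n) t' -> equivalent t t' -> t = t'.
Proof.
move=> n0.
have mixed u u' : reduced n u -> reduced n u' -> ~ equivalent u (negt u').
  move=> ru ru' e; have [_ nu pu] := reduced_nonneg _ _ n0 ru.
  have [_ _ pu'] := reduced_nonneg _ _ n0 ru'.
  by have := tsum_le _ _ nu e; rewrite tsum_negt; lia.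
move=> [rt|[u ru <-]] [rt'|[u' ru' <-]] e.
- exact: (reduced_unique _ _ _ n0 rt rt' e).
- by case: (mixed _ _ rt ru').
- by case: (mixed _ _ rt' ru); exact: equivalent_sym.
- congr negt; apply: (reduced_unique _ _ _ n0 ru ru').
  by move: (equivalent_negt _ _ e); rewrite !negtK.
Qed.

(** The sign of x + w, the denominator c, decides whether the triple or its
    opposite is to be reduced. *)
Lemma orbitsE n : (0 < n)%N ->
  orbits n = (fun t => Gorbit (surd n t)) @` signed (reduced n).
Proof.
move=> n0; apply/seteqP; split => O.
  move=> [z /(Mneg_surd _ _ n0)[t St ->] <-].
  suff [t' rt' e] : exists2 t' : triple, signed (reduced n) t' & equivalent t t'.
    exists t' => //; apply/Gorbit_eq => //; first exact: signed_selling rt'.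
    exact: equivalent_sym.
  case: t St => -[x y] w St.
  have := selling_neq0 _ _ _ _ n0 St; rewrite neq_lt => /orP[xw|xw]; last first.
    by have [t' e rt'] := exists_reduced _ _ _ _ n0 St xw; exists t' => //; left.
  have [|t' e rt'] := exists_reduced _ _ _ _ n0 (selling_negt _ _ St).
    by rewrite -opprD oppr_gt0.
  exists (negt t'); first by right; exists t'.
  by rewrite -[(x, y, w)]negtK; exact: equivalent_negt e.
move=> [t rt <-]; exists (surd n t) => //.
apply/(Mneg_surd _ _ n0); exists t => //; exact: signed_selling rt.
Qed.

Lemma Gorbit_surd_inj n : (0 < n)%N ->
  set_inj (signed (reduced n)) (fun t => Gorbit (surd n t)).
Proof.
move=> n0 t t' /set_mem rt /set_mem rt' /(Gorbit_eq _ _ _ n0) e.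
apply: (signed_reduced_unique n) => //.
by apply: e; exact: signed_selling.
Qed.

Definition ycycle (n : nat) (t : triple) : set algC :=
  [set surd n t; surd n (cyc t); surd n (cyc (cyc t))].

Lemma ymap_surd n t : (0 < n)%N -> selling n t ->
  ymap (surd n t) = surd n (cyc t).
Proof.
move=> n0 St; have -> : cyc t = transform 1 (-1) 1 0 t.
  by case: t {St} => -[x y] w; congr (_, _, _); ring.
by rewrite -mobius_surd // /mobius /ymap !mul1r addr0.
Qed.

Lemma totally_positive_surd n x y w : (0 < n)%N -> selling n (x, y, w) ->
  totally_positive n (surd n (x, y, w)) <-> 0 < x * (x + w).
Proof.
move=> n0 St; have c0 := selling_neq0 _ _ _ _ n0 St; split.
  by move=> [a [c [[/eqP c1 _ /(quad_inj _ _ _ _ _ n0 c0 c1) [-> ->]]]]].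
have [a [c hc]] : Mneg n (surd n (x, y, w)).
  by apply/Mneg_surd => //; exists (x, y, w).
exists a, c; split => //.
by case: hc => /eqP c1 _ /(quad_inj _ _ _ _ _ n0 c0 c1) [<- <-].
Qed.

(** Total positivity reads x (x + w) > 0, and cyclically.  As x + w, x + y and
    y + w have the same sign, these say that x, y and w have that sign. *)
Lemma totally_positive_triple n t : (0 < n)%N -> selling n t ->
  [/\ totally_positive n (surd n t), totally_positive n (ymap (surd n t))
    & totally_positive n (ymap (ymap (surd n t)))] <->
  signed (obtuse n) t.
Proof.
move=> n0 St; have S1 := selling_cyc _ _ St; have S2 := selling_cyc _ _ S1.
rewrite !ymap_surd //.
case: t St S1 S2 => -[x y] w St S1 S2.
have tpE x' y' w' S := propext (totally_positive_surd n x' y' w' n0 S).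
rewrite [cyc (x, y, w)]/= [cyc (y, w, x)]/= !tpE //.
split.
  move=> [h1 h2 h3]; have Sn := selling_negt _ _ St.
  have [x0|x0|x0] := ltgtP x 0; last by move: h1; rewrite x0 mul0r.
    right; exists (negt (x, y, w)); last exact: negtK.
    split => //; move: h1 h2 h3; rewrite nmulr_rgt0 // => xw.
    have [xy yw] := selling_definite _ _ _ _ n0 Sn ltac:(lia).
    rewrite !nmulr_lgt0; try lia.
    by move=> y0 w0; split; lia.
  left; split => //; move: h1 h2 h3; rewrite pmulr_rgt0 // => xw.
  have [xy yw] := selling_definite _ _ _ _ n0 St xw.
  by rewrite !pmulr_lgt0; try lia.
case=> [[_ [x0 y0 w0]]|[[[x' y'] w'] [_ [x0 y0 w0]] [<- <- <-]]].
  by split; rewrite pmulr_rgt0; lia.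
by split; rewrite nmulr_rgt0; lia.
Qed.

Lemma ycycle_cyc n t : ycycle n (cyc t) = ycycle n t.
Proof.
by case: t => -[x y] w; rewrite /ycycle [LHS]setUC setUA.
Qed.

Lemma TplusE n : (0 < n)%N -> Tplus n = ycycle n @` signed (necklace n).
Proof.
move=> n0; apply/seteqP; split => S.
  move=> [z [/(Mneg_surd _ _ n0)[t St ->]]] h1 h2 h3 ->.
  have [+ _] := totally_positive_triple _ _ n0 St.
  move=> /(_ (And3 h1 h2 h3)) {h1 h2 h3} ot.
  have S1 := selling_cyc _ _ St.
  rewrite !ymap_surd // -/(ycycle n t).
  case: ot => [ot|[u ot <-]].
    have [h|h|h] := necklace_rotation _ _ ot.
    - by exists t => //; left.
    - by exists (cyc t); [left | rewrite ycycle_cyc].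
    - by exists (cyc (cyc t)); [left | rewrite !ycycle_cyc].
  have negcyc v : cyc (negt v) = negt (cyc v) by case: v => -[? ?] ?.
  have [h|h|h] := necklace_rotation _ _ ot.
  - by exists (negt u) => //; right; exists u.
  - exists (negt (cyc u)); first by right; exists (cyc u).
    by rewrite -negcyc ycycle_cyc.
  - exists (negt (cyc (cyc u))); first by right; exists (cyc (cyc u)).
    by rewrite -!negcyc !ycycle_cyc.
move=> [t nt <-]; exists (surd n t).
have ot : signed (obtuse n) t.
  by case: nt => [[]|[u [] ? ? <-]]; [left | right; exists u].
have St : selling n t.
  by case: ot => [[]|[u [] ? ? <-]] //; exact: selling_negt.
have S1 := selling_cyc _ _ St.
have [_ /(_ ot) [h1 h2 h3]] := totally_positive_triple _ _ n0 St.
split => //; first by apply/Mneg_surd => //; exists t.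
by rewrite !ymap_surd.
Qed.

(** The orbit can be recovered from the totally positive triple as a set, which
    is how distinct necklaces are shown to give distinct triples. *)
Lemma bigcup_ycycle n t : (0 < n)%N -> selling n t ->
  \bigcup_(z in ycycle n t) Gorbit z = Gorbit (surd n t).
Proof.
move=> n0 St; have S1 := selling_cyc _ _ St; have S2 := selling_cyc _ _ S1.
have e1 : Gorbit (surd n (cyc t)) = Gorbit (surd n t).
  by apply/Gorbit_eq => //; exact/equivalent_sym/equivalent_cyc.
have e2 : Gorbit (surd n (cyc (cyc t))) = Gorbit (surd n (cyc t)).
  by apply/Gorbit_eq => //; exact/equivalent_sym/equivalent_cyc.
by rewrite /ycycle !bigcup_setU !bigcup_set1 e2 e1 !setUid.
Qed.

Lemma signed_sub A B : A `<=` B -> signed A `<=` signed B.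
Proof. by move=> AB t [/AB|[u /AB Bu <-]]; [left | right; exists u]. Qed.

Lemma ycycle_inj n : (0 < n)%N -> set_inj (signed (necklace n)) (ycycle n).
Proof.
move=> n0 t t' /set_mem nt /set_mem nt' E.
have sub : necklace n `<=` reduced n by move=> u; left.
have rt := signed_sub _ _ sub _ nt; have rt' := signed_sub _ _ sub _ nt'.
apply: (Gorbit_surd_inj _ n0); rewrite ?inE //.
by rewrite -!bigcup_ycycle ?E //; exact: signed_selling.
Qed.

(** * Counting *)

Lemma fincard_image (T U : choiceType) (f : T -> U) (A : set T) :
  finite_set A -> set_inj A f -> fincard (f @` A) = fincard A.
Proof.
move=> fA fI; rewrite /fincard fset_set_image // card_in_imfset //.
move=> x y; rewrite /= !in_fset_set // => Ax Ay.
exact: fI.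
Qed.

Lemma fincard_setU (T : choiceType) (A B : set T) :
  finite_set A -> finite_set B -> A `&` B = set0 ->
  fincard (A `|` B) = (fincard A + fincard B)%N.
Proof.
move=> fA fB AB0; rewrite /fincard fset_setU // cardfsU -fset_setI // AB0.
by rewrite fset_set0 cardfs0 subn0.
Qed.

Lemma fincard_set0 (T : choiceType) : fincard (set0 : set T) = 0%N.
Proof. by rewrite /fincard fset_set0 cardfs0. Qed.

Lemma fincard_set1 (T : choiceType) (x : T) : fincard [set x] = 1%N.
Proof. by rewrite /fincard fset_set1 cardfs1. Qed.

Lemma finite_box (n : nat) (A : set triple) :
  (forall x y w, A (x, y, w) ->
    [/\ 0 <= x <= n%:Z, 0 <= y <= n%:Z & 0 <= w <= n%:Z]) -> finite_set A.
Proof.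
move=> hA.
pose f (u : nat * nat * nat) : triple := (u.1.1%:Z, u.1.2%:Z, u.2%:Z).
apply: (@sub_finite_set _ _ (f @` (`I_n.+1 `*` `I_n.+1 `*` `I_n.+1))).
  move=> [[x y] w] /hA[hx hy hw].
  exists (absz x, absz y, absz w); last by rewrite /f /=; congr (_, _, _); lia.
  by rewrite /=; split; [split |] => /=; lia.
by apply: finite_image; do 2! [apply: finite_setX => //].
Qed.

Lemma finite_obtuse n : finite_set (obtuse n).
Proof.
apply: (finite_box n) => x y w [S [x0 y0 w0]].
move: S; rewrite /selling /= => S.
by split; nia.
Qed.

Lemma finite_necklace n : finite_set (necklace n).
Proof. by apply: sub_finite_set (finite_obtuse n) => t []. Qed.

Lemma finite_rect n : finite_set (rect n).
Proof.
apply: (finite_box n) => x y w [S [x0 w0 wy]].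
move: S; rewrite /selling /= x0 => S.
by split; nia.
Qed.

Lemma finite_reduced n : finite_set (reduced n).
Proof. by rewrite finite_setU; split; [exact: finite_necklace | exact: finite_rect]. Qed.

Lemma finite_signed A : finite_set A -> finite_set (signed A).
Proof. by move=> fA; rewrite finite_setU; split => //; exact: finite_image. Qed.

Lemma fincard_signed n A : (0 < n)%N -> A `<=` reduced n ->
  fincard (signed A) = (2 * fincard A)%N.
Proof.
move=> n0 AR; have fA := sub_finite_set AR (finite_reduced n).
rewrite fincard_setU //; last 2 first.
- exact: finite_image.
- rewrite predeqE => t; split => // -[At [u Au ut]].
  have [_ _ pt] := reduced_nonneg _ _ n0 (AR _ At).
  have [_ _ pu] := reduced_nonneg _ _ n0 (AR _ Au).
  by move: pt; rewrite -ut tsum_negt; lia.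
rewrite fincard_image // ?mul2n ?addnn // => t u _ _.
exact: (can_inj negtK).
Qed.

Lemma fincard_orbits n : (0 < n)%N ->
  fincard (orbits n) = (2 * (fincard (necklace n) + fincard (rect n)))%N.
Proof.
move=> n0; rewrite orbitsE // fincard_image; last 2 first.
- exact/finite_signed/finite_reduced.
- exact: Gorbit_surd_inj.
rewrite (fincard_signed n) // fincard_setU //.
- exact: finite_necklace.
- exact: finite_rect.
rewrite predeqE => -[[x y] w]; split => // -[[[_ [x0 _ _]] _] [_ [xE _ _]]].
by rewrite xE in x0.
Qed.

Lemma fincard_Tplus n : (0 < n)%N ->
  fincard (Tplus n) = (2 * fincard (necklace n))%N.
Proof.
move=> n0; rewrite TplusE // fincard_image; last 2 first.
- exact/finite_signed/finite_necklace.
- exact: ycycle_inj.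
by rewrite (fincard_signed n) // => t; left.
Qed.

(** The conditions a < b and a < c say that the Selling parameters b - a and
    c - a are positive. *)
Lemma AplusE n : (0 < n)%N ->
  Aplus n = (fun t : triple => let: (x, y, w) := t in
    (absz x, absz (x + y), absz (x + w))) @` obtuse n.
Proof.
move=> n0; apply/seteqP; split => -[[a b] c].
  move=> [[a0 b0 c0] [_ E ab ac]].
  exists (a%:Z, b%:Z - a%:Z, c%:Z - a%:Z); last by congr (_, _, _); lia.
  split; last by split; lia.
  rewrite /selling /=.
  have E' : b%:Z * c%:Z = a%:Z ^+ 2 + n%:Z by rewrite -!PoszM E PoszD PoszM; ring.
  by apply: (addrI (a%:Z ^+ 2)); rewrite -E'; ring.
move=> [[[x y] w] [S [x0 y0 w0]] [<- <- <-]].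
split; first by split; lia.
split; [|  |lia|lia].
  apply/Mneg_surd => //; exists (x, y, w) => //.
  by rewrite /surd; congr quad; lia.
by move: S; rewrite /selling /=; nia.
Qed.

Lemma finite_Aplus n : (0 < n)%N -> finite_set (Aplus n).
Proof. by move=> n0; rewrite AplusE //; apply/finite_image/finite_obtuse. Qed.

Lemma fincard_Aplus n : (0 < n)%N -> fincard (Aplus n) = fincard (obtuse n).
Proof.
move=> n0; rewrite AplusE // fincard_image //; first exact: finite_obtuse.
move=> [[x y] w] [[x' y'] w'] /set_mem[_ [? ? ?]] /set_mem[_ [? ? ?]] [? ? ?].
by congr (_, _, _); lia.
Qed.

Lemma obtuse_cyc n t : obtuse n t -> obtuse n (cyc t).
Proof.
move=> [St pt]; split; first exact: selling_cyc.
by case: t pt {St} => -[x y] w [].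
Qed.

Lemma cyc_inj : injective cyc.
Proof. by move=> [[x y] w] [[x' y'] w'] [-> -> ->]. Qed.

Lemma squarefree_nonsquare n d : squarefree n -> n <> 1%N -> (d * d)%N <> n.
Proof.
move=> [n0 h] n1 dn; have d1 : d = 1%N by apply: h; rewrite -mulnn dn.
by apply: n1; rewrite -dn d1.
Qed.

(** A cyclic class has fewer than three elements only if x = y = w, and then
    n = 3 x^2 with n square-free gives n = 3. *)
Lemma fincard_obtuse n : squarefree n -> n <> 3%N ->
  fincard (obtuse n) = (3 * fincard (necklace n))%N.
Proof.
move=> hn n3; have n0 : (0 < n)%N by case: hn.
have strict x y w : necklace n (x, y, w) -> x < y /\ x <= w.
  move=> [[S [x0 y0 w0]] [//|[xy yw]]]; case: n3.
  subst y w; case: hn => _ /(_ (absz x)) h.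
  have E : n%:Z = 3 * x ^+ 2 by move: S; rewrite /selling /=; lia.
  have x1 : absz x = 1%N.
    apply: h; apply/dvdnP; exists 3%N.
    by apply/eqP; rewrite -eqz_nat E; apply/eqP; lia.
  have x1' : x = 1 by lia.
  by move: E; rewrite x1'; lia.
have fN := finite_necklace n.
have -> : obtuse n =
    necklace n `|` (cyc @` necklace n `|` cyc @` (cyc @` necklace n)).
  apply/seteqP; split => t.
    move=> ot; have cyc3 : cyc (cyc (cyc t)) = t by case: t {ot} => -[].
    have [h|h|h] := necklace_rotation _ _ ot; first by left.
      by right; right; exists (cyc (cyc t)) => //; exists (cyc t).
    by right; left; exists (cyc (cyc t)).
  move=> [[]//|[[u [ou _] <-]|[_ [u [ou _] <-] <-]]]; first exact: obtuse_cyc.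
  by do 2!apply: obtuse_cyc.
rewrite !fincard_setU //; last 5 first.
- exact: finite_image.
- by do 2!apply: finite_image.
- rewrite predeqE => t; split => // -[[u nu <-] [_ [v nv <-] /cyc_inj E]].
  case: u v nu nv E => -[x y] w [[x' y'] w'] /strict h /strict h' [? ? ?].
  by subst; lia.
- by rewrite finite_setU; split; do ?apply: finite_image.
- rewrite predeqE => t; split => // -[nt [[u nu E]|[_ [u nu <-] E]]];
    case: u t nu nt E => -[x y] w [[x' y'] w'] /strict h /strict h' [? ? ?];
    by subst; lia.
rewrite !fincard_image //; try by move=> ? ? _ _; exact: cyc_inj.
  by lia.
exact: finite_image.
Qed.

Definition small_divisors (n : nat) : set nat :=
  [set d | (d %| n)%N /\ (d * d < n)%N].

Lemma finite_divisors n : (0 < n)%N -> finite_set [set d | (d %| n)%N].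
Proof.
move=> n0; apply: (@sub_finite_set _ _ `I_n.+1) => // d /= /dvdn_leq.
by rewrite ltnS; apply.
Qed.

Lemma finite_small_divisors n : finite_set (small_divisors n).
Proof. by apply: (@sub_finite_set _ _ `I_n.+1) => // d [] /= _; nia. Qed.

Lemma ndivisorsE n : (0 < n)%N ->
  ndivisors n = fincard [set d | (d %| n)%N].
Proof.
move=> n0; rewrite /ndivisors /fincard.
have -> : [set d | (d %| n)%N] = [set` [fset d in divisors n]%fset].
  by rewrite predeqE => d /=; rewrite !inE -dvdn_divisors.
by rewrite set_fsetK card_fseq undup_id // divisors_uniq.
Qed.

(** The involution d -> n / d exchanges the divisors below and above the square
    root of n. *)
Lemma ndivisors_nonsquare n : (0 < n)%N -> (forall d, (d * d)%N <> n) ->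
  ndivisors n = (2 * fincard (small_divisors n))%N.
Proof.
move=> n0 nsq; rewrite ndivisorsE //.
pose co d := (n %/ d)%N.
have -> : [set d | (d %| n)%N] = small_divisors n `|` co @` small_divisors n.
  apply/seteqP; split => d /=.
    move=> dn; have [lt|gt|E] := ltngtP (d * d)%N n; first by left.
      right; case/dvdnP: (dn) => k kE; exists k; last first.
        by rewrite /co kE mulKn //; lia.
      by split; [rewrite kE dvdn_mulr | nia].
    by case: (nsq _ E).
  by move=> [[]//|[k [kn _] <-]]; exact: dvdn_div.
have fS := finite_small_divisors n.
rewrite fincard_setU //; last 2 first.
- exact: finite_image.
- rewrite predeqE => d; split => // -[[dn dd] [k [kn kk] kE]].
  move: (divnK kn); rewrite -/(co k) kE => E.
  by nia.
rewrite fincard_image //; first by lia.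
move=> d k /set_mem[dn dd] /set_mem[kn kk] E.
have := divnK dn; have := divnK kn; rewrite -/(co d) -/(co k) E.
by nia.
Qed.

Lemma fincard_rect n : (0 < n)%N -> (forall d, (d * d)%N <> n) ->
  fincard (rect n) = fincard (small_divisors n).
Proof.
move=> n0 nsq.
have -> : rect n =
    (fun d : nat => (0, (n %/ d)%N%:Z, d%:Z) : triple) @` small_divisors n.
  apply/seteqP; split => [[[x y] w]|t].
    move=> [S [x0 w0 wy]]; subst x.
    have E : (absz w * absz y)%N = n by move: S; rewrite /selling /=; lia.
    exists (absz w); last by congr (_, _, _); rewrite -?E ?mulKn; lia.
    split; first by rewrite -E dvdn_mulr.
    by have := nsq (absz w); nia.
  move=> [d [dn dd] <-]; have E := divnK dn.
  split; first by rewrite /selling /=; lia.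
  by split => //; nia.
by rewrite fincard_image //; [exact: finite_small_divisors | move=> d k _ _ []].
Qed.

(** * Parity of the number of necklaces *)

(** The fixed points of the exchange of b and c. *)
Definition isosceles (n : nat) : set triple :=
  [set t | obtuse n t /\ let: (_, y, w) := t in y = w].

(** The exchange of y and w pairs the solutions with y < w with those with
    w < y. *)
Lemma fincard_obtuse_isosceles n :
  exists k, fincard (obtuse n) = (2 * k + fincard (isosceles n))%N.
Proof.
pose L := [set t | obtuse n t /\ let: (_, y, w) := t in y < w].
pose sw (t : triple) : triple := let: (x, y, w) := t in (x, w, y).
have fO := finite_obtuse n.
have fL : finite_set L by apply: sub_finite_set fO => t [].
have fI : finite_set (isosceles n) by apply: sub_finite_set fO => t [].
have swO t : obtuse n t -> obtuse n (sw t).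
  case: t => -[x y] w [S [x0 y0 w0]]; split; last by split.
  by move: S; rewrite /selling /= => <-; ring.
exists (fincard L).
have -> : obtuse n = (L `|` sw @` L) `|` isosceles n.
  apply/seteqP; split => [[[x y] w]|t].
    move=> ot; have [yw|yw|yw] := ltgtP y w; last by right.
      by left; left.
    by left; right; exists (x, w, y) => //; split => //; exact: (swO _ ot).
  by move=> [[[]|[u [ou _] <-]]|[]] //; exact: swO.
rewrite !fincard_setU //; last 4 first.
- exact: finite_image.
- rewrite predeqE => t; split => // -[[_ h] [[[x y] w] [_ h'] E]].
  by subst t; move: h h' => /=; lia.
- by rewrite finite_setU; split => //; exact: finite_image.
- rewrite predeqE => t; split => // -[[[_ h]|[[[x y] w] [_ h'] E]] [_ h2]].
    by case: t h h2 => -[x y] w; lia.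
  by subst t; move: h' h2 => /=; lia.
rewrite fincard_image //; first by lia.
by move=> [[x y] w] [[x' y'] w'] _ _ [-> -> ->].
Qed.

Lemma selling_isosceles n x y : selling n (x, y, y) -> 0 < x -> 0 < y ->
  (absz y * (2 * absz x + absz y))%N = n.
Proof.
rewrite /selling /= => S x0 y0; apply/eqP; rewrite -eqz_nat; apply/eqP.
rewrite -S PoszM PoszD PoszM !gtz0_abs //; ring.
Qed.

(** Solutions with w = y are factorizations n = y (2 x + y) with y below the
    cofactor; for odd n the parity condition on the two factors holds for every
    factorization. *)
Lemma fincard_isosceles_odd n : odd n ->
  fincard (isosceles n) = fincard (small_divisors n).
Proof.
move=> on.
have -> : isosceles n =
    (fun d : nat => ((n %/ d - d)./2%N%:Z, d%:Z, d%:Z) : triple) @` small_divisors n.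
  apply/seteqP; split => [[[x y] w]|t].
    move=> [[S [x0 y0 w0]] yw]; subst w.
    have E := selling_isosceles _ _ _ S x0 y0.
    exists (absz y).
      by split; [rewrite -E dvdn_mulr | nia].
    by rewrite -[in LHS]E mulKn; [congr (_, _, _); lia | lia].
  move=> [d [dn dd] <-].
  have E := divnK dn; move: E dd; set k := (n %/ d)%N => E dd.
  have : odd k && odd d by rewrite -oddM E.
  move=> /andP[ok od].
  have dk : (d < k)%N by nia.
  have d0 : (0 < d)%N by case: (d) od.
  have kE : k = (2 * (k - d)./2 + d)%N by lia.
  move: E kE; set h := (k - d)./2 => E kE.
  split; last by [].
  split; last by split; lia.
  by rewrite /selling /= -E kE; lia.
rewrite fincard_image //; first exact: finite_small_divisors.
by move=> d k _ _ [].
Qed.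

(** In n = y (2 x + y) both factors have the same parity, so an even n would be
    divisible by 4, against square-freeness. *)
Lemma isosceles_even n : squarefree n -> ~~ odd n -> isosceles n = set0.
Proof.
move=> [n0 sqf] en; rewrite predeqE => -[[x y] w]; split => //.
move=> [[S [x0 y0 w0]] yw]; subst w.
have E := esym (selling_isosceles _ _ _ S x0 y0).
have ey : ~~ odd (absz y).
  by move: en; rewrite E oddM oddD mul2n odd_double /= andbb.
have : 2%N = 1%N :> nat.
  apply: sqf; rewrite E -mulnn; apply: dvdn_mul; first by lia.
  by lia.
by [].
Qed.

Lemma ndivisors_double m : odd m -> ndivisors (2 * m) = (2 * ndivisors m)%N.
Proof.
move=> om; have m0 : (0 < m)%N by case: m om.
rewrite !ndivisorsE //; last by lia.
have -> : [set d | (d %| 2 * m)%N] =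
    [set d | (d %| m)%N] `|` (fun d => 2 * d)%N @` [set d | (d %| m)%N].
  apply/seteqP; split => d /=.
    move=> dm; have [od|ed] := boolP (odd d).
      by left; move: dm; rewrite Gauss_dvdr // coprimen2.
    have [k dE] : exists k, d = (2 * k)%N by exists d./2; lia.
    by right; exists k; rewrite // -(@dvdn_pmul2l 2) // -dE.
  by move=> [dm|[k km <-]]; [exact: dvdn_mull | rewrite dvdn_pmul2l].
have fD := finite_divisors _ m0.
rewrite fincard_setU //; last 2 first.
- exact: finite_image.
- rewrite predeqE => d; split => // -[/= dm [k _ kd]].
  by move: (dvdn_odd dm om); rewrite -kd mul2n odd_double.
rewrite fincard_image //; first by lia.
by move=> d k _ _; lia.
Qed.

Lemma squarefree_half n : squarefree n -> ~~ odd n ->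
  exists m, [/\ n = (2 * m)%N, odd m & squarefree m].
Proof.
move=> [n0 sqf] en; have nE : n = (2 * n./2)%N by lia.
exists n./2; split => //.
  apply/negPn/negP => eh.
  have : 2%N = 1%N :> nat.
    by apply: sqf; rewrite nE -mulnn dvdn_pmul2l //; lia.
  by [].
split; first by lia.
by move=> d dn; apply: sqf; rewrite nE dvdn_mull.
Qed.

Lemma fincard_necklace3 : fincard (necklace 3) = 1%N.
Proof.
have -> : necklace 3 = [set (1, 1, 1)].
  apply/seteqP; split => [[[x y] w]|_ ->].
    move=> [[S [x0 y0 w0]] _]; move: S; rewrite /selling /= => S.
    by congr (_, _, _); nia.
  by split; [split | right].
exact: fincard_set1.
Qed.

Lemma fincard_rect3 : fincard (rect 3) = 1%N.
Proof.
have -> : rect 3 = [set (0, 3, 1)].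
  apply/seteqP; split => [[[x y] w]|_ ->].
    move=> [S [x0 y0 w0]]; subst x; move: S; rewrite /selling /= => S.
    have w1 : w = 1 by nia.
    by congr (_, _, _); lia.
  by split.
exact: fincard_set1.
Qed.

Lemma fincard_necklace1 : fincard (necklace 1) = 0%N.
Proof.
have -> : necklace 1 = set0; last exact: fincard_set0.
rewrite predeqE => -[[x y] w]; split => // -[[S [x0 y0 w0]] _].
by move: S; rewrite /selling /=; nia.
Qed.

Lemma fincard_rect1 : fincard (rect 1) = 1%N.
Proof.
have -> : rect 1 = [set (0, 1, 1)].
  apply/seteqP; split => [[[x y] w]|_ ->].
    move=> [S [x0 y0 w0]]; subst x; move: S; rewrite /selling /= => S.
    by congr (_, _, _); nia.
  by split.
exact: fincard_set1.
Qed.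

(** For n = 3 the count of positive solutions by cyclic classes fails, so that
    case is computed. *)
Lemma fincard_orbits_mod4 n : squarefree n -> n <> 1%N -> n <> 2%N ->
  (fincard (orbits n) = 0 %[mod 4])%N.
Proof.
move=> hn n1 n2; have n0 : (0 < n)%N by case: hn.
rewrite fincard_orbits //.
have [->|/eqP n3] := eqVneq n 3%N; first by rewrite fincard_necklace3 fincard_rect3.
have nsq d := squarefree_nonsquare n d hn n1.
have E3 := fincard_obtuse _ hn n3.
have [k Ek] := fincard_obtuse_isosceles n.
have Er := fincard_rect _ n0 nsq.
have [on|en] := boolP (odd n).
  have Ei := fincard_isosceles_odd _ on.
  by move: E3 Ek Er Ei; lia.
have := isosceles_even _ hn en => Ei.
rewrite Ei fincard_set0 in Ek.
have Ed := ndivisors_nonsquare _ n0 nsq.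
have [m [nE om hm]] := squarefree_half _ hn en.
have m1 : m <> 1%N by move=> m1; apply: n2; rewrite nE m1.
have m0 : (0 < m)%N by case: hm.
have nsqm d := squarefree_nonsquare m d hm m1.
have Em := ndivisors_nonsquare _ m0 nsqm.
have E2 := ndivisors_double _ om; rewrite -nE in E2.
by move: E3 Ek Er Ed Em E2; lia.
Qed.

Theorem theorem2p2 (n : nat) (hn : squarefree n) :
  [/\ finite_set (orbits n), finite_set (Tplus n) & finite_set (Aplus n)] /\
  [/\ fincard (orbits n) =
        (if n == 1%N then 2 else ndivisors n + fincard (Tplus n))%N,
      (fincard (orbits n))%:R =
        (if n == 1%N then 2
         else if n == 3%N then 4
         else (ndivisors n)%:R + 2 / 3 * (fincard (Aplus n))%:R) :> rat
    & n <> 1%N -> n <> 2%N -> (fincard (orbits n) = 0 %[mod 4])%N].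
Proof.
have n0 : (0 < n)%N by case: hn.
split.
  split; last exact: finite_Aplus.
    by rewrite orbitsE //; exact/finite_image/finite_signed/finite_reduced.
  by rewrite TplusE //; exact/finite_image/finite_signed/finite_necklace.
have orbitsTplus : n <> 1%N ->
    fincard (orbits n) = (ndivisors n + fincard (Tplus n))%N.
  move=> n1; have nsq d := squarefree_nonsquare n d hn n1.
  rewrite fincard_orbits // fincard_Tplus // ndivisors_nonsquare //.
  by rewrite fincard_rect //; lia.
split; last exact: fincard_orbits_mod4.
  case: eqP => [->|//].
  by rewrite fincard_orbits // fincard_necklace1 fincard_rect1.
case: eqP => [->|n1].
  by rewrite fincard_orbits // fincard_necklace1 fincard_rect1.
case: eqP => [->|n3].
  by rewrite fincard_orbits // fincard_necklace3 fincard_rect3.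
rewrite orbitsTplus // fincard_Tplus // fincard_Aplus // fincard_obtuse //.
by rewrite natrD !natrM; field.
Qed.
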